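(* Let $p>2$, let $h$ satisfy $\lim_{t\to\infty}\frac{h'(t)}{t^{p-1}h(t)}=0$, and let $\{(\lambda_n,\mu_n,u_n)\}$ be a sequence of solutions (in the sense of the context) with $\mu_n\to\infty$ as $n\to\infty$. Let $(r_{k,n})\subset(0,1)$, $k\in\mathbb N\cup\{0\}$, be the sequences of bubble centers described in the context. Then, for any sequence $(r_n)\subset(0,1)$ such that $u_n(r_n)/\mu_n\to0$, up to a subsequence, \[ \lim_{n\to\infty}p\int_0^{r_n}\lambda_nu_n^{p-1}f(u_n)\,r\,dr=\infty; \] especially, \[ \lim_{n\to\infty}p\mu_n^{p-1}\int_0^{r_n}\lambda_nf(u_n)\,r\,dr=\infty. \] Moreover (up to a subsequence), \[ \lim_{n\to\infty}\frac{\log\frac1{\lambda_n}}{\mu_n^p}=0, \] \[ \lim_{n\to\infty}\frac{\log\frac1{r_{k,n}}}{\mu_n^p}=\frac{\delta_k^p}{2}\quad\text{for all }k\in\mathbb N\cup\{0\}, \] and \[ \lim_{n\to\infty}p\mu_n^{p-1}u_n(r)=\infty\quad\text{for all }r\in[0,1). \]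
   Context: $h:[0,\infty)\to\mathbb{R}$ is a nonnegative $C^1$ function and there is $t_0>0$ with $h(t)>0$ for all $t\ge t_0$; $f(t)=h(t)e^{t^p}$. A sequence of solutions $\{(\lambda_n,\mu_n,u_n)\}$ means: for every $n\in\mathbb N$, $\lambda_n>0$, $\mu_n>0$, and $u_n$ is a classical solution on $[0,1]$ of $-u_n''-\frac1r u_n'=\lambda_nf(u_n)$, $u_n>0$ in $(0,1)$, $u_n(0)=\mu_n$, $u_n'(0)=0=u_n(1)$. ''Up to a subsequence'' means after passing to a subsequence in $n$, not relabelled. The numbers $a_k,\delta_k$ (depending only on $p>2$): $a_0=2$, $\delta_0=1$, and for $k\in\mathbb N$ the numbers $\delta_k\in(0,\delta_{k-1})$ and $a_k\in(0,2)$ are uniquely determined recursively by \[ \frac{2p}{2+a_{k-1}}\Big(1-\frac{\delta_k}{\delta_{k-1}}\Big)-1+\Big(\frac{\delta_k}{\delta_{k-1}}\Big)^p=0,\qquad a_k=2-\Big(\frac{\delta_k}{\delta_{k-1}}\Big)^{p-1}(2+a_{k-1}). \] Bubble centers: for each $k\in\mathbb N\cup\{0\}$, $(r_{k,n})\subset(0,1)$ is a sequence (existing after passing to a subsequence) with $u_n(r_{k,n})/\mu_n\to\delta_k$ and $p\lambda_nr_{k,n}^2u_n(r_{k,n})^{p-1}f(u_n(r_{k,n}))\to a_k^2/2$ as $n\to\infty$; for $k=0$ moreover $r_{0,n}/\gamma_{0,n}\to2\sqrt2$, where $\gamma_{0,n}>0$ is defined by $p\lambda_n\mu_n^{p-1}f(\mu_n)\gamma_{0,n}^2=1$.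 *)

(* Defs.v *)
From Stdlib Require Import Reals Lra.
From Coquelicot Require Import Coquelicot.

Open Scope R_scope.

(* Real power t^s for t >= 0 and s > 0.  Stdlib's [Rpower] cannot be used
   directly at the origin: since [ln 0 = 0], it gives [Rpower 0 s = 1]. *)
Definition powr (t s : R) : R := if Rle_dec t 0 then 0 else Rpower t s.

Definition nonlinearity (p : R) (h : R -> R) (t : R) : R :=
  h t * exp (powr t p).

Definition half_line (t : R) : Prop := 0 <= t.
Definition unit_interval (r : R) : Prop := 0 <= r <= 1.

(* [D_in g g' D x] and [continue_in g D x] are relative to [D], hence one-sided
   at the endpoints: the values of a function outside [D] play no role. *)
Definition C1_on (D : R -> Prop) (g : R -> R) : Prop :=
  exists g1 : R -> R,
    forall x, D x -> D_in g g1 D x /\ continue_in g1 D x.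

(* C^2 solutions, up to the boundary, on [0,1].  The equation is imposed away
   from r = 0, where the coefficient 1/r is singular. *)
Definition is_solution (p : R) (h : R -> R) (lambda mu : R) (u : R -> R) : Prop :=
  0 < lambda /\ 0 < mu /\
  exists u1 u2 : R -> R,
    (forall r, unit_interval r ->
       D_in u u1 unit_interval r /\
       D_in u1 u2 unit_interval r /\
       continue_in u2 unit_interval r) /\
    (forall r, 0 < r <= 1 ->
       - u2 r - 1 / r * u1 r = lambda * nonlinearity p h (u r)) /\
    (forall r, 0 < r < 1 -> 0 < u r) /\
    u 0 = mu /\ u1 0 = 0 /\ u 1 = 0.

Definition bubble_parameters (p : R) (a delta : nat -> R) : Prop :=
  a 0%nat = 2 /\ delta 0%nat = 1 /\
  forall k : nat,
    0 < delta (S k) < delta k /\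
    0 < a (S k) < 2 /\
    2 * p / (2 + a k) * (1 - delta (S k) / delta k) - 1
      + powr (delta (S k) / delta k) p = 0 /\
    a (S k) = 2 - powr (delta (S k) / delta k) (p - 1) * (2 + a k).

Definition bubble_centers (p : R) (h : R -> R) (a delta : nat -> R)
    (lambda mu : nat -> R) (u : nat -> R -> R) (rc : nat -> nat -> R) : Prop :=
  (forall k n : nat, 0 < rc k n < 1) /\
  (forall k : nat,
     is_lim_seq (fun n => u n (rc k n) / mu n) (delta k)) /\
  (forall k : nat,
     is_lim_seq (fun n => p * lambda n * (rc k n) ^ 2
                          * powr (u n (rc k n)) (p - 1)
                          * nonlinearity p h (u n (rc k n)))
                ((a k) ^ 2 / 2)) /\
  exists gamma0 : nat -> R,
    (forall n : nat,
       0 < gamma0 n /\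
       p * lambda n * powr (mu n) (p - 1) * nonlinearity p h (mu n)
         * (gamma0 n) ^ 2 = 1) /\
    is_lim_seq (fun n => rc 0%nat n / gamma0 n) (2 * sqrt 2).

Definition strictly_increasing (phi : nat -> nat) : Prop :=
  forall m n : nat, (m < n)%nat -> (phi m < phi n)%nat.

(* Main.v *)
Require Import Defs.
From Stdlib Require Import Reals Lra.
From Coquelicot Require Import Coquelicot.

Open Scope R_scope.

(* In the variable s = ln (1 / r) a solution u_n is concave and vanishes at
   s = 0.  Let s_k and X be ln (1 / r_{k,n}) and ln lambda_n divided by mu_n^p.
   Taking logarithms in the relation defining the bubble centers gives
   X - 2 s_k -> - delta_k^p.  Concavity on the chord from r_{0,n} through r_{k,n}
   to r = 1 then bounds s_k by a multiple of delta_k, so X -> 0 once delta_k -> 0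
   is known, and s_k -> delta_k^p / 2 follows.  Concavity below r_{k,n} gives
   mu_n^(p-1) u_n(r) >= 2 ln (1 / r) delta_k^(1-p) (1 + o(1)).  For the energy, the
   flux w = - r u' at r_{k,n}, times mu_n^(p-1), lies asymptotically between
   (2 - a_k) / (p delta_k^(p-1)) and 2 / delta_k^(p-1), so between two centers
   with delta_k' << delta_k the integral of u^(p-1) dw picks up at least a
   fixed amount, because 2 - a_k >= 2 (1 - 2 / p)^(p-1).

   That delta_k -> 0 comes from d_k = 1 - delta_{k+1} / delta_k: second-order Taylor
   bounds for t^p at t = 1 yield 1 / d_{k+1} <= 1 / d_k + (p - 1), so the sum of the
   d_k diverges. *)

(** * Real powers *)

Lemma powr_pos_eq (t s : R) : 0 < t -> powr t s = Rpower t s.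
Proof. intros Ht; unfold powr; destruct (Rle_dec t 0); lra. Qed.

Lemma is_derive_Rpower (s y : R) :
  0 < y -> is_derive (fun t => Rpower t s) y (s * Rpower y (s - 1)).
Proof. intros Hy; apply is_derive_Reals, derivable_pt_lim_power; exact Hy. Qed.

(** Differentiability is asked only in the open interval, because the functions extended from [0,1]
    below need not have a two-sided derivative at 0 and 1. *)
Lemma monotone_of_derive_nonneg (f df : R -> R) (a b : R) :
  a <= b ->
  (forall x, a < x < b -> is_derive f x (df x)) ->
  (forall x, a <= x <= b -> continuity_pt f x) ->
  (forall x, a < x < b -> 0 <= df x) -> f a <= f b.
Proof.
intros Hab Hd Hc Hp.
destruct (Req_dec a b) as [->|Hne]; [lra|].
assert (Hlt : a < b) by lra.
assert (pr1 : forall c, a < c < b -> derivable_pt f c)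
  by (intros c Hcb; exists (df c); apply is_derive_Reals, Hd, Hcb).
assert (pr2 : forall c, a < c < b -> derivable_pt id c)
  by (intros c _; apply derivable_pt_id).
destruct (MVT f id a b pr1 pr2 Hlt Hc) as [c [Hcab E]].
{ intros c _; apply derivable_continuous_pt, derivable_pt_id. }
assert (E1 : derive_pt f c (pr1 c Hcab) = df c)
  by (apply derive_pt_eq_0, is_derive_Reals, Hd, Hcab).
assert (E2 : derive_pt id c (pr2 c Hcab) = 1)
  by (apply derive_pt_eq_0, derivable_pt_lim_id).
rewrite E1, E2 in E; unfold id in E.
assert (0 <= (b - a) * df c) by (apply Rmult_le_pos; [lra|apply Hp, Hcab]).
lra.
Qed.

Lemma derive_continuity_pt (f : R -> R) (x l : R) :
  is_derive f x l -> continuity_pt f x.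
Proof.
intros H; apply derivable_continuous_pt; exists l; apply is_derive_Reals, H.
Qed.

Lemma Rpower_1_l (s : R) : Rpower 1 s = 1.
Proof. unfold Rpower; rewrite ln_1, Rmult_0_r; apply exp_0. Qed.

Lemma Rpower_base_le (s x y : R) : 0 <= s -> 0 < x <= y -> Rpower x s <= Rpower y s.
Proof. intros; apply Rle_Rpower_l; lra. Qed.

(** The difference of the two sides has derivative q (t^(q-1) - 1), which has the sign of t - 1, so
    its minimum is its value 0 at t = 1. *)
Lemma Rpower_bernoulli (q y : R) : 1 <= q -> 0 < y -> 1 + q * (y - 1) <= Rpower y q.
Proof.
intros Hq Hy.
set (F := fun t => Rpower t q - 1 - q * (t - 1)).
assert (HF : forall t, 0 < t -> is_derive F t (q * (Rpower t (q - 1) - 1))).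
{ intros t Ht; unfold F.
  evar_last.
  apply @is_derive_minus.
  apply @is_derive_minus; [apply is_derive_Rpower, Ht|apply is_derive_const].
  instantiate (1 := q). auto_derive; [easy|ring].
  unfold minus, plus, opp, zero; simpl; ring. }
assert (F1 : F 1 = 0) by (unfold F; rewrite Rpower_1_l; ring).
cut (0 <= F y); [unfold F; lra|].
destruct (Rle_dec 1 y) as [H|H].
- rewrite <- F1.
  apply (monotone_of_derive_nonneg F (fun t => q * (Rpower t (q - 1) - 1))); auto.
  + intros; apply HF; lra.
  + intros t Ht; eapply derive_continuity_pt, HF; lra.
  + intros t Ht; apply Rmult_le_pos; [lra|].
    assert (Rpower 1 (q - 1) <= Rpower t (q - 1)) by (apply Rpower_base_le; lra).
    rewrite Rpower_1_l in H0; lra.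
- assert (- F y <= - F 1); [|lra].
  apply (monotone_of_derive_nonneg (fun t => - F t)
           (fun t => - (q * (Rpower t (q - 1) - 1)))); [lra|..].
  + intros t Ht; apply @is_derive_opp, HF; lra.
  + intros t Ht; apply continuity_pt_opp; eapply derive_continuity_pt, HF; lra.
  + intros t Ht.
    assert (Rpower t (q - 1) <= Rpower 1 (q - 1)) by (apply Rpower_base_le; lra).
    rewrite Rpower_1_l in H0.
    assert (0 <= q * (1 - Rpower t (q - 1))) by (apply Rmult_le_pos; lra). lra.
Qed.

(* The remainder of the second-order Taylor polynomial at 1 is nondecreasing:
   its derivative is the remainder in Bernoulli's inequality. *)
Lemma Rpower_taylor2_mono (p x y : R) : 2 <= p -> 0 < x <= y ->
  Rpower x p - p * (x - 1) - p * (p - 1) / 2 * (x - 1) ^ 2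
  <= Rpower y p - p * (y - 1) - p * (p - 1) / 2 * (y - 1) ^ 2.
Proof.
intros Hp Hxy.
set (F := fun t => Rpower t p - (p * (t - 1) + p * (p - 1) / 2 * (t - 1) ^ 2)).
assert (HF : forall t, 0 < t ->
  is_derive F t (p * (Rpower t (p - 1) - (1 + (p - 1) * (t - 1))))).
{ intros t Ht; unfold F.
  evar_last.
  apply @is_derive_minus; [apply is_derive_Rpower, Ht|].
  instantiate (1 := p + p * (p - 1) * (t - 1)). auto_derive; [easy|field].
  unfold minus, plus, opp; simpl; ring. }
cut (F x <= F y); [unfold F; lra|].
eapply monotone_of_derive_nonneg; [lra|..].
- intros t Ht; apply HF; lra.
- intros t Ht; eapply derive_continuity_pt, HF; lra.
- intros t Ht; apply Rmult_le_pos; [lra|].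
  assert (H := Rpower_bernoulli (p - 1) t); lra.
Qed.

Lemma Rpower_taylor2_below (p x : R) : 2 <= p -> 0 < x <= 1 ->
  Rpower x p <= 1 - p * (1 - x) + p * (p - 1) / 2 * (1 - x) ^ 2.
Proof.
intros Hp Hx.
assert (H := Rpower_taylor2_mono p x 1 Hp Hx); rewrite Rpower_1_l in H; lra.
Qed.

Lemma Rpower_taylor2_above (p y : R) : 2 <= p -> 1 <= y ->
  1 + p * (y - 1) + p * (p - 1) / 2 * (y - 1) ^ 2 <= Rpower y p.
Proof.
intros Hp Hy.
assert (H := Rpower_taylor2_mono p 1 y Hp); rewrite Rpower_1_l in H; lra.
Qed.

Lemma Rpower_pos (x s : R) : 0 < Rpower x s.
Proof. apply exp_pos. Qed.

Lemma Rpower_Rinv_l (x s : R) : 0 < x -> Rpower (/ x) s = / Rpower x s.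
Proof.
intros Hx; unfold Rpower; rewrite ln_Rinv by exact Hx.
rewrite <- exp_Ropp; f_equal; ring.
Qed.

Lemma Rpower_minus_1 (x s : R) : 0 < x -> Rpower x s = x * Rpower x (s - 1).
Proof.
intros Hx.
replace s with (1 + (s - 1)) at 1 by ring.
rewrite Rpower_plus, Rpower_1; auto.
Qed.

Lemma ln_le_minus_1 (x : R) : 0 < x -> ln x <= x - 1.
Proof.
intros Hx; assert (H := exp_ineq1_le (ln x)); rewrite exp_ln in H; lra.
Qed.

(** * The parameters a_k and delta_k *)

Section Bubbles.
Variables (p : R) (a delta : nat -> R).
Hypotheses (hp : 2 < p) (hpar : bubble_parameters p a delta).

Lemma delta_pos k : 0 < delta k.
Proof.
destruct hpar as [_ [H0 H]]; destruct k; [rewrite H0; lra|apply (H k)].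
Qed.

Lemma delta_le_1 k : delta k <= 1.
Proof.
destruct hpar as [_ [H0 H]]; induction k; [rewrite H0; lra|].
specialize (H k); lra.
Qed.

Lemma a_bounds k : 0 < a k <= 2.
Proof.
destruct hpar as [H0 [_ H]]; destruct k; [rewrite H0; lra|].
destruct (H k) as [_ [Ha _]]; lra.
Qed.

Lemma ratio_bounds k : 0 < delta (S k) / delta k < 1.
Proof.
destruct hpar as [_ [_ H]]; destruct (H k) as [Hd _].
assert (Hk := delta_pos k).
split; [apply Rdiv_lt_0_compat; lra|].
apply Rlt_div_l; lra.
Qed.

Lemma ratio_equation k (x := delta (S k) / delta k) :
  2 * p * (1 - x) = (2 + a k) * (1 - Rpower x p).
Proof.
destruct hpar as [_ [_ H]]; destruct (H k) as [_ [_ [E _]]].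
assert (Hx := ratio_bounds k); fold x in E, Hx; assert (Ha := a_bounds k).
rewrite powr_pos_eq in E by lra.
replace (2 * p * (1 - x)) with ((2 + a k) * (2 * p / (2 + a k) * (1 - x)))
  by (field; lra).
replace (2 * p / (2 + a k) * (1 - x)) with (1 - Rpower x p) by lra.
ring.
Qed.

Lemma a_succ k (x := delta (S k) / delta k) :
  2 - a (S k) = Rpower x (p - 1) * (2 + a k).
Proof.
destruct hpar as [_ [_ H]]; destruct (H k) as [_ [_ [_ E]]].
assert (Hx := ratio_bounds k); fold x in E, Hx.
rewrite powr_pos_eq in E by lra. lra.
Qed.

(** In [ratio_equation] the right side is below 4, since a_k <= 2 and x^p > 0. This bound, uniform
    in k, is what makes each energy increment at least a fixed constant. *)
Lemma ratio_lower k : 1 - 2 / p < delta (S k) / delta k.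
Proof.
assert (E := ratio_equation k); cbv zeta in E.
assert (Hx := ratio_bounds k); assert (Ha := a_bounds k).
set (x := delta (S k) / delta k) in *.
assert (HP := Rpower_pos x p).
assert ((1 - x) * p < 2).
{ assert ((2 + a k) * (1 - Rpower x p) < 4 * 1); [|lra].
  assert (0 <= 1 - Rpower x p).
  { apply Rmult_le_reg_l with (2 + a k); [lra|]. rewrite Rmult_0_r, <- E.
    apply Rmult_le_pos; lra. }
  apply Rle_lt_trans with (4 * (1 - Rpower x p)); [|lra].
  apply Rmult_le_compat_r; lra. }
assert (1 - x < 2 / p); [|lra].
apply Rlt_div_r; lra.
Qed.

(** Insert the second-order upper bound for x^p, x < 1, into [ratio_equation] and divide by p d. *)
Lemma a_upper k (d := 1 - delta (S k) / delta k) :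
  a k * (1 - (p - 1) / 2 * d) <= (p - 1) * d.
Proof.
assert (E := ratio_equation k); cbv zeta in E.
assert (Hx := ratio_bounds k); assert (Ha := a_bounds k).
set (x := delta (S k) / delta k) in *.
assert (HT := Rpower_taylor2_below p x); fold d in HT.
assert (Hd : 0 < d) by (unfold d; lra).
assert (H : (2 + a k) * (p * d * (1 - (p - 1) / 2 * d)) <= 2 * p * d).
{ unfold d at 3; rewrite E; apply Rmult_le_compat_l; [lra|].
  assert (Rpower x p <= 1 - p * d + p * (p - 1) / 2 * d ^ 2) by (apply HT; lra).
  lra. }
assert (H' : (p * d) * ((2 + a k) * (1 - (p - 1) / 2 * d)) <= (p * d) * 2) by lra.
apply Rmult_le_reg_l in H'; [lra|apply Rmult_lt_0_compat; lra].
Qed.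

(** Mirror image of [a_upper]: written with y = 1/x, the recursion for a_{k+1} turns
    [ratio_equation] into the same kind of relation for 2 - a_{k+1}, to which the Taylor bound above
    1 applies. Finally e = 1/x - 1 is replaced by the smaller d. *)
Lemma a_lower k (d := 1 - delta (S k) / delta k) :
  (p - 1) * d <= a (S k) * (1 + (p - 1) / 2 * d).
Proof.
assert (E := ratio_equation k); assert (E' := a_succ k); cbv zeta in E, E'.
assert (Hx := ratio_bounds k); assert (Ha := a_bounds k).
assert (Ha' := a_bounds (S k)).
set (x := delta (S k) / delta k) in *.
assert (Hd : 0 < d) by (unfold d; lra).
assert (HQ := Rpower_pos x p).
assert (Hy : 1 < / x) by (rewrite <- Rinv_1; apply Rinv_lt_contravar; lra).
assert (HT : 1 + p * (/ x - 1) + p * (p - 1) / 2 * (/ x - 1) ^ 2 <= / Rpower x p).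
{ rewrite <- Rpower_Rinv_l by lra; apply Rpower_taylor2_above; lra. }
rewrite (Rpower_minus_1 x p) in E, HT, HQ by lra.
set (Q := Rpower x (p - 1)) in *.
set (e := / x - 1) in *.
assert (He : d <= e).
{ unfold d, e. assert (x + / x = 2 + (1 - x) ^ 2 / x) by (field; lra).
  assert (0 <= (1 - x) ^ 2 / x) by (apply Rdiv_le_0_compat; [apply pow2_ge_0|lra]).
  lra. }
assert (HQ' : 0 < Q) by apply Rpower_pos.
(* [2 p e = (2 - a') (y^p - 1)] with [y = 1/x = 1 + e] *)
assert (E2 : 2 * p * e = (2 - a (S k)) * (/ (x * Q) - 1)).
{ rewrite E'. replace (Q * (2 + a k) * (/ (x * Q) - 1))
    with ((2 + a k) * (1 - x * Q) / x) by (field; lra).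
  rewrite <- E; unfold e; field; lra. }
assert (H : (2 - a (S k)) * (p * e * (1 + (p - 1) / 2 * e)) <= 2 * p * e).
{ rewrite E2; apply Rmult_le_compat_l; lra. }
assert (H' : (p * e) * ((2 - a (S k)) * (1 + (p - 1) / 2 * e)) <= (p * e) * 2) by lra.
apply Rmult_le_reg_l in H'; [|apply Rmult_lt_0_compat; lra].
assert ((2 - a (S k)) * (1 + (p - 1) / 2 * d) <= (2 - a (S k)) * (1 + (p - 1) / 2 * e)).
{ apply Rmult_le_compat_l; [lra|]. apply Rplus_le_compat_l, Rmult_le_compat_l; lra. }
lra.
Qed.

(** Eliminating a_{k+1} between [a_lower] at k and [a_upper] at k + 1 leaves D <= D' + (p - 1) D D';
    dividing by D D' gives the claim. *)
Lemma step_inv k (d := fun j => 1 - delta (S j) / delta j) :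
  / d (S k) <= / d k + (p - 1).
Proof.
assert (H1 := a_upper (S k)); assert (H2 := a_lower k); cbv zeta in H1, H2.
assert (Hx := ratio_bounds k); assert (Hx' := ratio_bounds (S k)).
assert (Ha := a_bounds (S k)).
fold (d k) in H2; fold (d (S k)) in H1.
assert (Hd : 0 < d k) by (unfold d; lra).
assert (Hd' : 0 < d (S k)) by (unfold d; lra).
set (D := d k) in *; set (D' := d (S k)) in *; set (A := a (S k)) in *.
assert (H : D <= D' + (p - 1) * D * D').
{ destruct (Rle_dec (1 - (p - 1) / 2 * D') 0) as [Hn|Hn].
  - assert (D * 1 <= D * ((p - 1) / 2 * D')) by (apply Rmult_le_compat_l; lra).
    assert (0 <= D * ((p - 1) / 2 * D')); [|lra].
    lra.
  - assert (((p - 1) * D) * (1 - (p - 1) / 2 * D')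
       <= (A * (1 + (p - 1) / 2 * D)) * (1 - (p - 1) / 2 * D'))
      by (apply Rmult_le_compat_r; lra).
    assert ((1 + (p - 1) / 2 * D) * (A * (1 - (p - 1) / 2 * D'))
       <= (1 + (p - 1) / 2 * D) * ((p - 1) * D')).
    { apply Rmult_le_compat_l; [|lra].
      assert (0 < (p - 1) / 2 * D) by (apply Rmult_lt_0_compat; lra); lra. }
    apply Rmult_le_reg_l with (p - 1); lra. }
apply Rmult_le_reg_l with (D * D'); [apply Rmult_lt_0_compat; lra|].
replace (D * D' * / D') with D by (field; lra).
replace (D * D' * (/ D + (p - 1))) with (D' + (p - 1) * D * D') by (field; lra).
exact H.
Qed.

(** The product delta_k^(p-1) b_k does not increase with k: by [step_inv] 1 / d_k <= b_k, so ln
    delta drops by at least 1 / b_k at each step, while ln b rises by at most (p - 1) / b_k. Since b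
    grows linearly, this quantifies the divergence of the sum of the d_k. *)
Lemma ln_delta_bound k (b := fun j => / (1 - delta 1%nat / delta 0%nat) + INR j * (p - 1)) :
  (p - 1) * ln (delta k) + ln (b k) <= ln (b 0%nat).
Proof.
assert (Hb : forall j, 0 < b j).
{ intros j; unfold b. assert (Hx := ratio_bounds 0).
  assert (0 < / (1 - delta 1%nat / delta 0%nat)) by (apply Rinv_0_lt_compat; lra).
  assert (0 <= INR j * (p - 1)) by (apply Rmult_le_pos; [apply pos_INR|lra]). lra. }
assert (Hd : forall j, / (1 - delta (S j) / delta j) <= b j).
{ induction j.
  - unfold b; simpl INR; lra.
  - apply Rle_trans with (1 := step_inv j).
    unfold b in *; rewrite S_INR; lra. }
induction k.
- destruct hpar as [_ [H0 _]]; rewrite H0, ln_1; lra.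
- assert (Hx := ratio_bounds k).
  assert (Hk := delta_pos k); assert (Hbk := Hb k); assert (HbS := Hb (S k)).
  assert (H1 : ln (delta (S k)) - ln (delta k) <= - / b k).
  { rewrite <- ln_div; [|apply delta_pos|exact Hk].
    apply Rle_trans with (1 := ln_le_minus_1 _ (proj1 Hx)).
    assert (/ b k <= 1 - delta (S k) / delta k); [|lra].
    rewrite <- (Rinv_inv (1 - delta (S k) / delta k)).
    apply Rinv_le_contravar; [apply Rinv_0_lt_compat; lra|apply Hd]. }
  assert (H2 : ln (b (S k)) - ln (b k) <= (p - 1) * / b k).
  { rewrite <- ln_div by assumption.
    apply Rle_trans with (b (S k) / b k - 1);
      [apply ln_le_minus_1, Rdiv_lt_0_compat; assumption|].
    right; replace (b (S k)) with (b k + (p - 1)) by (unfold b; rewrite S_INR; ring).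
    field; lra. }
  assert ((p - 1) * (ln (delta (S k)) - ln (delta k)) <= (p - 1) * - / b k)
    by (apply Rmult_le_compat_l; lra).
  lra.
Qed.

Lemma delta_small (eps : R) : 0 < eps -> exists k, delta k < eps.
Proof.
intros He.
set (b0 := / (1 - delta 1%nat / delta 0%nat)).
assert (Hb0 : 0 < b0) by (apply Rinv_0_lt_compat; assert (H := ratio_bounds 0); lra).
(* M = b_0 eps^(1-p) is the value that b_k has to exceed for [ln_delta_bound] to force delta_k <
   eps. *)
set (M := b0 * exp (- (p - 1) * ln eps)).
destruct (INR_unbounded (M / (p - 1))) as [k Hk].
exists k.
apply ln_lt_inv; [apply delta_pos|exact He|].
assert (H := ln_delta_bound k); cbv beta zeta in H; fold b0 in H.
change (INR 0) with 0 in H; rewrite Rmult_0_l, Rplus_0_r in H.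
assert (HM : 0 < M) by (apply Rmult_lt_0_compat; [exact Hb0|apply exp_pos]).
assert (Hl : ln M < ln (b0 + INR k * (p - 1))).
{ apply ln_increasing; [exact HM|].
  apply Rlt_div_l in Hk; lra. }
unfold M in Hl; rewrite ln_mult, ln_exp in Hl; [|exact Hb0|apply exp_pos].
apply Rmult_lt_reg_l with (p - 1); lra.
Qed.
End Bubbles.

(** * Concavity of a solution in ln (1 / r) *)

(** Composition with this retraction onto [0,1] turns continuity relative to [0,1] into continuity
    on the whole line, as the integration lemmas require. *)
Definition clamp (r : R) : R := Rmax 0 (Rmin 1 r).

Lemma clamp_id (r : R) : unit_interval r -> clamp r = r.
Proof. intros Hr; unfold unit_interval in Hr; unfold clamp; rewrite Rmin_right, Rmax_right; lra. Qed.

Lemma clamp_bounds (r : R) : unit_interval (clamp r).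
Proof.
unfold unit_interval, clamp; split; [apply Rmax_l|].
apply Rmax_lub; [lra|apply Rmin_l].
Qed.

Lemma clamp_lipschitz (x y : R) : Rabs (clamp y - clamp x) <= Rabs (y - x).
Proof.
unfold clamp, Rmin; destruct (Rle_dec 1 x), (Rle_dec 1 y); unfold Rmax;
  repeat (destruct (Rle_dec _ _)); unfold Rabs;
  repeat (destruct (Rcase_abs _)); lra.
Qed.

Lemma continue_in_clamp (f : R -> R) :
  (forall r, unit_interval r -> continue_in f unit_interval r) ->
  forall x, continuity_pt (fun r => f (clamp r)) x.
Proof.
intros Hf x eps He.
destruct (Hf (clamp x) (clamp_bounds x) eps He) as [d [Hd H]].
exists d; split; [exact Hd|].
intros y [_ Hy]; simpl in *; unfold Rdist in *.
(* [continue_in] says nothing about the base point itself, and distinct points may be clamped to the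
   same one. *)
destruct (Req_dec (clamp y) (clamp x)) as [E|E].
- rewrite E, Rminus_diag, Rabs_R0; exact He.
- apply H; split; [split; [apply clamp_bounds|exact (not_eq_sym E)]|].
  apply Rle_lt_trans with (2 := Hy), clamp_lipschitz.
Qed.

Lemma D_in_interior_derive (D : R -> Prop) (f f1 : R -> R) (x r : R) :
  0 < r -> (forall y, Rabs (y - x) < r -> D y) -> D_in f f1 D x -> is_derive f x (f1 x).
Proof.
intros Hr HD Hf; apply is_derive_Reals; intros eps He.
destruct (Hf eps He) as [d [Hd H]].
assert (Hm : 0 < Rmin d r) by (apply Rmin_pos; assumption).
exists (mkposreal _ Hm); simpl; intros k Hk Hkd.
specialize (H (x + k)); simpl in H; unfold Rdist in H.
replace (x + k - x) with k in H by ring.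
assert (H1 := Rmin_l d r); assert (H2 := Rmin_r d r).
apply H; split; [split|lra].
- apply HD; replace (x + k - x) with k by ring; lra.
- intros E; apply Hk; lra.
Qed.

Lemma D_in_unit_interval_derive (f f1 : R -> R) (x : R) :
  0 < x < 1 -> D_in f f1 unit_interval x -> is_derive f x (f1 x).
Proof.
intros Hx; apply (D_in_interior_derive _ _ _ _ (Rmin x (1 - x))).
- apply Rmin_pos; lra.
- intros y Hy; assert (H1 := Rmin_l x (1 - x)); assert (H2 := Rmin_r x (1 - x)).
  apply Rabs_def2 in Hy; unfold unit_interval; lra.
Qed.

Lemma derive_clamp (f : R -> R) (x l : R) :
  0 < x < 1 -> is_derive f x l -> is_derive (fun r => f (clamp r)) x l.
Proof.
intros Hx; apply is_derive_ext_loc.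
assert (Hm : 0 < Rmin x (1 - x)) by (apply Rmin_pos; lra).
exists (mkposreal _ Hm); intros y Hy.
rewrite clamp_id; [reflexivity|].
assert (H1 := Rmin_l x (1 - x)); assert (H2 := Rmin_r x (1 - x)).
unfold ball in Hy; simpl in Hy; unfold AbsRing_ball, abs, minus, plus, opp in Hy; simpl in Hy.
apply Rabs_def2 in Hy; unfold unit_interval; lra.
Qed.

(** * Solutions as radial profiles *)

Definition flux (f : R -> R) (lambda : R) (u : R -> R) (r : R) : R :=
  RInt (fun s => lambda * f (u s) * s) 0 r.

(* For a solution, [flux f lambda u r] is [- r u'(r)], which is the derivative of [u] with
   respect to [ln (1 / r)]; the two bounds on [u a - u b] express that [u] is
   concave in that variable. *)
Record radial_profile (p : R) (f : R -> R) (lambda mu : R) (u : R -> R) : Prop := {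
  profile_0 : u 0 = mu;
  profile_1 : u 1 = 0;
  profile_pos : forall r, 0 <= r < 1 -> 0 < u r;
  profile_decr : forall x y, 0 <= x <= y -> y <= 1 -> u y <= u x;
  profile_slope_ge : forall x y, 0 < x <= y -> y <= 1 ->
    flux f lambda u x * (ln y - ln x) <= u x - u y;
  profile_slope_le : forall x y, 0 < x <= y -> y <= 1 ->
    u x - u y <= flux f lambda u y * (ln y - ln x);
  profile_source_ge : forall r, 0 <= r <= 1 -> 0 <= lambda * f (u r) * r;
  profile_flux : forall x y, 0 <= x <= y -> y <= 1 ->
    is_RInt (fun r => lambda * f (u r) * r) x y
      (flux f lambda u y - flux f lambda u x);
  profile_weighted : forall x, 0 <= x < 1 ->
    ex_RInt (fun r => lambda * powr (u r) (p - 1) * f (u r) * r) 0 x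
}.

Lemma constant_of_derive_0 (f : R -> R) (a b : R) :
  a <= b ->
  (forall x, a < x < b -> is_derive f x 0) ->
  (forall x, a <= x <= b -> continuity_pt f x) -> f a = f b.
Proof.
intros Hab Hd Hc; apply Rle_antisym.
- apply (monotone_of_derive_nonneg f (fun _ => 0)); auto; intros; lra.
- apply Ropp_le_cancel.
  apply (monotone_of_derive_nonneg (fun x => - f x) (fun _ => 0)); auto.
  + intros x Hx; replace 0 with (- 0) by ring; apply @is_derive_opp, Hd, Hx.
  + intros x Hx; apply continuity_pt_opp, Hc, Hx.
  + intros; lra.
Qed.

(** Multiplied by r, the equation reads (- r u')' = lambda f(u) r, so - r u' is the flux w, and w is
    nondecreasing because the source is nonnegative. Both slope bounds follow from the monotonicity
    on [x,y] of u + c ln r, whose derivative is (c - w) / r, with c = w(x) or c = w(y). *)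
Lemma solution_profile (p : R) (h : R -> R) (lambda mu : R) (u : R -> R) :
  (forall t, 0 <= t -> 0 <= h t) ->
  is_solution p h lambda mu u ->
  radial_profile p (nonlinearity p h) lambda mu u.
Proof.
intros Hh [Hl [Hmu [u1 [u2 [Hreg [Heq [Hpos [E0 [E10 E1]]]]]]]]].
set (U := fun r => u (clamp r)).
set (U1 := fun r => u1 (clamp r)).
set (U2 := fun r => u2 (clamp r)).
assert (cU : forall x, continuity_pt U x).
{ apply continue_in_clamp; intros r Hr; destruct (Hreg r Hr) as [H _].
  apply (cont_deriv _ _ _ _ H). }
assert (cU1 : forall x, continuity_pt U1 x).
{ apply continue_in_clamp; intros r Hr; destruct (Hreg r Hr) as [_ [H _]].
  apply (cont_deriv _ _ _ _ H). }
assert (cU2 : forall x, continuity_pt U2 x).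
{ apply continue_in_clamp; intros r Hr; apply (Hreg r Hr). }
assert (dU : forall x, 0 < x < 1 -> is_derive U x (U1 x)).
{ intros x Hx; unfold U1; rewrite clamp_id by (unfold unit_interval; lra).
  apply derive_clamp, D_in_unit_interval_derive, Hreg; unfold unit_interval; lra. }
assert (dU1 : forall x, 0 < x < 1 -> is_derive U1 x (U2 x)).
{ intros x Hx; unfold U2; rewrite clamp_id by (unfold unit_interval; lra).
  apply derive_clamp, D_in_unit_interval_derive, Hreg; unfold unit_interval; lra. }
assert (UE : forall x, 0 <= x <= 1 -> U x = u x) by (intros x Hx; unfold U; rewrite clamp_id; auto).
assert (Upos : forall r, 0 <= r < 1 -> 0 < u r).
{ intros r Hr; destruct (Req_dec r 0) as [->|Hne]; [lra|apply Hpos; lra]. }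
(* This is - (r u')', continuous on the line and equal to the source on [0,1]; at r = 0, where no
   equation is imposed, both vanish because u'(0) = 0. *)
set (g := fun r => - U1 r - r * U2 r).
assert (gE : forall r, 0 <= r <= 1 -> lambda * nonlinearity p h (u r) * r = g r).
{ intros r Hr; unfold g, U1, U2; rewrite clamp_id by exact Hr.
  destruct (Req_dec r 0) as [->|Hne]; [lra|].
  rewrite <- Heq by lra; field; exact Hne. }
assert (cg : forall x, continuity_pt g x).
{ intros x; unfold g; apply continuity_pt_minus; [apply continuity_pt_opp, cU1|].
  apply continuity_pt_mult; [apply continuity_pt_id|apply cU2]. }
assert (cg' : forall x, continuous g x) by (intros x; apply continuity_pt_filterlim, cg).
assert (g0 : forall r, 0 <= r <= 1 -> 0 <= g r).
{ intros r Hr; rewrite <- gE by exact Hr.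
  apply Rmult_le_pos; [apply Rmult_le_pos; [lra|]|lra].
  apply Rmult_le_pos; [|left; apply exp_pos].
  apply Hh; destruct (Req_dec r 1) as [->|Hne]; [lra|left; apply Upos; lra]. }
assert (ig : forall x y, is_RInt g x y (RInt g x y)).
{ intros x y; apply (@RInt_correct R_CompleteNormedModule), ex_RInt_continuous; intros; apply cg'. }
set (w := (fun r => RInt g 0 r) : R -> R).
assert (dw : forall x, is_derive w x (g x)).
{ intros x; apply (@is_derive_RInt R_NormedModule g w 0 x); [|apply cg'].
  apply filter_forall; intros y; apply ig. }
assert (w0 : w 0 = 0) by (unfold w; rewrite RInt_point; reflexivity).
assert (wI : forall x y, is_RInt g x y (w y - w x)).
{ intros x y. replace (w y - w x) with (RInt g x y); [apply ig|].
  assert (H : w x + RInt g x y = w y)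
  by (apply (RInt_Chasles g 0 x y); eexists; apply ig).
lra. }
assert (wmono : forall x y, 0 <= x <= y -> y <= 1 -> w x <= w y).
{ intros x y Hx Hy; apply (monotone_of_derive_nonneg w g); [lra|..].
  - intros; apply dw.
  - intros; eapply derive_continuity_pt, dw.
  - intros; apply g0; lra. }
(* The function t u'(t) + w(t) has zero derivative inside (0,1) and vanishes at 0. *)
assert (wE : forall x, 0 <= x <= 1 -> x * U1 x = - w x).
{ intros x Hx.
  cut (0 * U1 0 + w 0 = x * U1 x + w x); [rewrite w0; lra|].
  apply (constant_of_derive_0 (fun t => t * U1 t + w t)); [lra|..].
  - intros t Ht; evar_last.
    apply @is_derive_plus; [|apply dw].
    apply is_derive_Reals, (derivable_pt_lim_mult id U1 t 1 (U2 t));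
      [apply derivable_pt_lim_id|apply is_derive_Reals, dU1; lra].
    unfold g, plus, id; simpl; ring.
  - intros t Ht; apply continuity_pt_plus; [|eapply derive_continuity_pt, dw].
    apply continuity_pt_mult; [apply continuity_pt_id|apply cU1]. }
assert (Hln : forall t, 0 < t -> is_derive ln t (/ t)).
{ intros t Ht; apply is_derive_Reals, derivable_pt_lim_ln, Ht. }
assert (Hcln : forall c x t, 0 < x -> x <= t ->
  continuity_pt (fun t => U t + c * ln t) t).
{ intros c x t Hx Ht; apply continuity_pt_plus; [apply cU|].
  apply continuity_pt_mult; [apply continuity_pt_const; intros ? ?; reflexivity|].
  eapply derive_continuity_pt, Hln; lra. }
assert (dcln : forall c t, 0 < t < 1 ->
  is_derive (fun t => U t + c * ln t) t ((c - w t) * / t)).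
{ intros c t Ht; evar_last.
  apply @is_derive_plus; [apply dU; lra|apply @is_derive_scal, Hln; lra].
  unfold plus, scal; simpl; unfold mult; simpl.
  replace (w t) with (- (t * U1 t)) by (rewrite wE; lra); field; lra. }
assert (wF : forall x, 0 <= x <= 1 -> flux (nonlinearity p h) lambda u x = w x).
{ intros x Hx; apply RInt_ext; rewrite Rmin_left, Rmax_right by lra.
  intros t Ht; apply gE; lra. }
constructor; auto.
- intros x y Hx Hy; rewrite <- !UE by lra.
  apply Ropp_le_cancel, (monotone_of_derive_nonneg (fun t => - U t) (fun t => - U1 t)); [lra|..].
  + intros t Ht; apply @is_derive_opp, dU; lra.
  + intros t Ht; apply continuity_pt_opp, cU.
  + intros t Ht. assert (H := wE t); assert (H' := wmono 0 t).
    apply Rmult_le_reg_l with t; lra.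
- intros x y Hx Hy; rewrite wF, <- !UE by lra.
  cut (- (U x + w x * ln x) <= - (U y + w x * ln y)); [lra|].
  apply (monotone_of_derive_nonneg (fun t => - (U t + w x * ln t))
           (fun t => - ((w x - w t) * / t))); [lra|..].
  + intros t Ht; apply @is_derive_opp, dcln; lra.
  + intros t Ht; apply continuity_pt_opp, (Hcln _ x); lra.
  + intros t Ht; replace (- ((w x - w t) * / t)) with ((w t - w x) * / t) by ring.
    apply Rmult_le_pos; [assert (H := wmono x t); lra|left; apply Rinv_0_lt_compat; lra].
- intros x y Hx Hy; rewrite wF, <- !UE by lra.
  cut (U x + w y * ln x <= U y + w y * ln y); [lra|].
  apply (monotone_of_derive_nonneg (fun t => U t + w y * ln t)
           (fun t => (w y - w t) * / t)); [lra|..].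
  + intros t Ht; apply dcln; lra.
  + intros t Ht; apply (Hcln _ x); lra.
  + intros t Ht.
    apply Rmult_le_pos; [assert (H := wmono t y); lra|left; apply Rinv_0_lt_compat; lra].
- intros r Hr; rewrite gE; auto.
- intros x y Hx Hy; rewrite !wF by lra; apply (is_RInt_ext g); [|apply wI].
  rewrite Rmin_left, Rmax_right by lra; intros t Ht; rewrite gE; lra.
- intros x Hx.
  (* Up to x < 1 the solution stays positive, so the weight is an [Rpower] of a positive continuous
     function. *)
  apply (ex_RInt_ext (fun r => Rpower (U r) (p - 1) * g r)).
  + rewrite Rmin_left, Rmax_right by lra; intros t Ht.
    rewrite <- gE, UE, powr_pos_eq by (try apply Upos; lra); simpl; ring.
  + apply (@ex_RInt_continuous R_CompleteNormedModule).
    rewrite Rmin_left, Rmax_right by lra; intros t Ht.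
    apply continuity_pt_filterlim, continuity_pt_mult; [|apply cg].
    apply (continuity_pt_comp U (fun y => Rpower y (p - 1))); [apply cU|].
    eapply derive_continuity_pt, is_derive_Rpower; rewrite UE by lra; apply Upos; lra.
Qed.

(** * Asymptotics along the sequence *)

(** Integrating the hypothesis on (ln h)' from a large T gives |ln h(t)| <= |ln h(T)| + eps/2 t^p,
    because eps/2 t^p + ln h and eps/2 t^p - ln h are both nondecreasing there. Thus h does not
    affect the leading exponential t^p. *)
Lemma ln_nonlinearity_growth (p : R) (h : R -> R) (t0 : R) :
  2 < p -> C1_on half_line h -> 0 < t0 -> (forall t, t0 <= t -> 0 < h t) ->
  is_lim (fun t => Derive h t / (powr t (p - 1) * h t)) p_infty 0 ->
  is_lim (fun t => ln (h t) / Rpower t p) p_infty 0.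
Proof.
intros Hp [h1 Hh1] Ht0 Hpos Hlim.
assert (Hd : forall t, 0 < t -> is_derive h t (h1 t)).
{ intros t Ht; apply (D_in_interior_derive half_line _ _ _ t Ht);
    [|apply Hh1; unfold half_line; lra].
  intros y Hy; apply Rabs_def2 in Hy; unfold half_line; lra. }
apply is_lim_spec in Hlim; apply is_lim_spec; intros eps.
assert (He : 0 < eps / 2) by (assert (H := cond_pos eps); lra).
destruct (Hlim (mkposreal _ He)) as [M HM]; simpl in HM.
set (T := Rmax (Rmax M t0) 1 + 1).
assert (HT : M < T /\ t0 < T /\ 1 < T).
{ unfold T; assert (H1 := Rmax_l (Rmax M t0) 1); assert (H2 := Rmax_r (Rmax M t0) 1).
  assert (H3 := Rmax_l M t0); assert (H4 := Rmax_r M t0); lra. }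
(* The factor p, harmless since p >= 1, makes the right side eps/2 times the derivative of t^p. *)
assert (Hbd : forall t, T <= t ->
  Rabs (h1 t / h t) <= eps / 2 * (p * Rpower t (p - 1))).
{ intros t Ht; specialize (HM t); rewrite (is_derive_unique _ _ _ (Hd t ltac:(lra))) in HM.
  rewrite powr_pos_eq, Rminus_0_r in HM by lra.
  assert (HP := Rpower_pos t (p - 1)); assert (Hht := Hpos t ltac:(lra)).
  replace (h1 t / h t) with (h1 t / (Rpower t (p - 1) * h t) * Rpower t (p - 1)) by (field; lra).
  rewrite Rabs_mult, (Rabs_pos_eq (Rpower _ _)) by lra.
  apply Rle_trans with (eps / 2 * Rpower t (p - 1)).
  - apply Rmult_le_compat_r; [lra|]. left; apply HM; lra.
  - apply Rmult_le_compat_l; [lra|].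
    assert (1 * Rpower t (p - 1) <= p * Rpower t (p - 1)); [apply Rmult_le_compat_r|]; lra. }
assert (Hdl : forall t, T <= t -> is_derive (fun t => ln (h t)) t (h1 t / h t)).
{ intros t Ht; evar_last.
  apply (is_derive_comp ln h t (/ h t) (h1 t)); [|apply Hd; lra].
  apply is_derive_Reals, derivable_pt_lim_ln, Hpos; lra.
  reflexivity. }
assert (Hdp : forall c t, T <= t ->
  is_derive (fun t => c * Rpower t p) t (c * (p * Rpower t (p - 1)))).
{ intros c t Ht; apply (is_derive_scal (fun t => Rpower t p)), is_derive_Rpower; lra. }
assert (Hup : forall t, T <= t ->
  Rabs (ln (h t)) <= Rabs (ln (h T)) + eps / 2 * Rpower t p).
{ intros t Ht.
  assert (HP := Rmult_lt_0_compat _ _ He (Rpower_pos T p)).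
  assert (ln (h T) + eps / 2 * Rpower T p <= ln (h t) + eps / 2 * Rpower t p).
  { apply (monotone_of_derive_nonneg (fun t => ln (h t) + eps / 2 * Rpower t p)
      (fun t => h1 t / h t + eps / 2 * (p * Rpower t (p - 1)))); [lra|..].
    - intros x Hx; apply @is_derive_plus; [apply Hdl|apply Hdp]; lra.
    - intros x Hx; eapply derive_continuity_pt, @is_derive_plus; [apply Hdl|apply Hdp]; lra.
    - intros x Hx; assert (H := Hbd x ltac:(lra)); apply Rabs_le_between in H; lra. }
  assert (eps / 2 * Rpower T p - ln (h T) <= eps / 2 * Rpower t p - ln (h t)).
  { apply (monotone_of_derive_nonneg (fun t => eps / 2 * Rpower t p - ln (h t))
      (fun t => eps / 2 * (p * Rpower t (p - 1)) - h1 t / h t)); [lra|..].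
    - intros x Hx; apply @is_derive_minus; [apply Hdp|apply Hdl]; lra.
    - intros x Hx; eapply derive_continuity_pt, @is_derive_minus; [apply Hdp|apply Hdl]; lra.
    - intros x Hx; assert (H0 := Hbd x ltac:(lra)); apply Rabs_le_between in H0; lra. }
  assert (H1 := Rle_abs (ln (h T))); assert (H2 := Rle_abs (- ln (h T))).
  rewrite Rabs_Ropp in H2; apply Rabs_le; lra. }
(* Beyond the second bound |ln h(T)| < eps/2 t <= eps/2 t^p, which absorbs the constant. *)
exists (Rmax T (2 * Rabs (ln (h T)) / eps)); intros t Ht.
assert (H1 := Rmax_l T (2 * Rabs (ln (h T)) / eps)).
assert (H2 := Rmax_r T (2 * Rabs (ln (h T)) / eps)).
assert (HP := Rpower_pos t p).
rewrite Rminus_0_r; unfold Rdiv; rewrite Rabs_mult, Rabs_inv, (Rabs_pos_eq (Rpower t p)) by lra.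
apply Rlt_div_l; [exact HP|].
apply Rle_lt_trans with (1 := Hup t ltac:(lra)).
assert (H3 : t <= Rpower t p).
{ rewrite <- (Rpower_1 t) at 1 by lra; apply Rle_Rpower; lra. }
assert (2 * Rabs (ln (h T)) < t * eps) by (apply Rlt_div_l; [apply cond_pos|lra]).
assert (t * eps <= Rpower t p * eps) by (apply Rmult_le_compat_r; [left; apply cond_pos|exact H3]).
lra.
Qed.

(** * Elementary limits and inequalities for a single profile *)

Lemma is_lim_seq_eventually_lt (x : nat -> R) (l m : R) :
  is_lim_seq x l -> l < m -> eventually (fun n => x n < m).
Proof.
intros H Hlm; apply is_lim_seq_spec in H.
assert (He : 0 < m - l) by lra.
generalize (H (mkposreal _ He)); apply filter_imp; intros n Hn; simpl in Hn.
apply Rabs_def2 in Hn; lra.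
Qed.

Lemma is_lim_seq_eventually_gt (x : nat -> R) (l m : R) :
  is_lim_seq x l -> m < l -> eventually (fun n => m < x n).
Proof.
intros H Hlm; apply is_lim_seq_spec in H.
assert (He : 0 < l - m) by lra.
generalize (H (mkposreal _ He)); apply filter_imp; intros n Hn; simpl in Hn.
apply Rabs_def2 in Hn; lra.
Qed.

Lemma is_lim_seq_Rpower (x : nat -> R) (l s : R) :
  0 < l -> is_lim_seq x l -> is_lim_seq (fun n => Rpower (x n) s) (Rpower l s).
Proof.
intros Hl; apply (is_lim_seq_continuous (fun t => Rpower t s)).
eapply derive_continuity_pt, is_derive_Rpower, Hl.
Qed.

Lemma is_lim_ln_div_Rpower (s : R) :
  1 <= s -> is_lim (fun t => ln t / Rpower t s) p_infty 0.
Proof.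
intros Hs.
apply (is_lim_le_le_loc (fun _ => 0) (fun t => ln t / t)).
- exists 1; intros t Ht.
  assert (Hln : 0 <= ln t) by (rewrite <- ln_1; apply ln_le; lra).
  assert (HP : t <= Rpower t s)
    by (rewrite <- (Rpower_1 t) at 1 by lra; apply Rle_Rpower; lra).
  split; [apply Rdiv_le_0_compat; lra|].
  apply Rmult_le_compat_l; [exact Hln|apply Rinv_le_contravar; lra].
- apply is_lim_const.
- apply is_lim_div_ln_p.
Qed.

Lemma eventually_and (P Q : nat -> Prop) :
  eventually P -> eventually Q -> eventually (fun n => P n /\ Q n).
Proof. apply filter_and. Qed.

(* Chord comparison, in the variable [ln (1 / r)], between the points [x], [y]
   and the boundary point 1, where [u] vanishes. *)
Lemma profile_chord (p : R) (f : R -> R) (lambda mu : R) (u : R -> R) (x y : R) :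
  radial_profile p f lambda mu u -> 0 < x <= y -> y <= 1 ->
  (u x - u y) * - ln y <= u y * (ln y - ln x).
Proof.
intros H Hx Hy.
assert (H1 := profile_slope_le _ _ _ _ _ H x y Hx Hy).
assert (H2 := profile_slope_ge _ _ _ _ _ H y 1 ltac:(lra) ltac:(lra)).
rewrite (profile_1 _ _ _ _ _ H), ln_1 in H2.
assert (L1 : ln x <= ln y) by (apply ln_le; lra).
assert (L2 : ln y <= 0) by (rewrite <- ln_1; apply ln_le; lra).
apply Rle_trans with (flux f lambda u y * (ln y - ln x) * - ln y).
- apply Rmult_le_compat_r; lra.
- apply Rle_trans with ((flux f lambda u y * (0 - ln y)) * (ln y - ln x)); [lra|].
  apply Rmult_le_compat_r; lra.
Qed.

(** Since u decreases, the weight u^(p-1) on [x,y] is smallest at y; what remains integrates to the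
    flux increment. *)
Lemma profile_weighted_ge (p : R) (f : R -> R) (lambda mu : R) (u : R -> R) (x y : R) :
  1 <= p -> radial_profile p f lambda mu u -> 0 <= x <= y -> y < 1 ->
  Rpower (u y) (p - 1) * (flux f lambda u y - flux f lambda u x)
  <= RInt (fun r => lambda * powr (u r) (p - 1) * f (u r) * r) 0 y
     - RInt (fun r => lambda * powr (u r) (p - 1) * f (u r) * r) 0 x.
Proof.
intros Hp H Hx Hy.
set (G := fun r => lambda * powr (u r) (p - 1) * f (u r) * r).
assert (Ey : ex_RInt G 0 y) by (apply (profile_weighted _ _ _ _ _ H); lra).
assert (Ex : ex_RInt G 0 x) by (apply (profile_weighted _ _ _ _ _ H); lra).
assert (Exy : ex_RInt G x y) by (apply (ex_RInt_Chasles_2 G 0 x y); [lra|exact Ey]).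
assert (C : RInt G 0 x + RInt G x y = RInt G 0 y) by (apply (RInt_Chasles G); assumption).
apply Rle_trans with (RInt G x y); [|lra].
assert (HI := profile_flux _ _ _ _ _ H x y Hx ltac:(lra)).
apply (is_RInt_scal _ _ _ (Rpower (u y) (p - 1))) in HI.
rewrite <- (is_RInt_unique _ _ _ _ HI : _ = Rpower (u y) (p - 1) * _).
apply RInt_le; [lra|eexists; apply HI|exact Exy|].
intros r Hr; unfold G, scal; simpl; unfold mult; simpl.
assert (Hu := profile_pos _ _ _ _ _ H y ltac:(lra)).
assert (Hd := profile_decr _ _ _ _ _ H r y ltac:(lra) ltac:(lra)).
assert (H0 := profile_source_ge _ _ _ _ _ H r ltac:(lra)).
rewrite powr_pos_eq by lra.
replace (lambda * Rpower (u r) (p - 1) * f (u r) * r)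
  with (Rpower (u r) (p - 1) * (lambda * f (u r) * r)) by ring.
apply Rmult_le_compat_r; [exact H0|apply Rpower_base_le; lra].
Qed.

(** Here the weight is bounded by its value at the origin, u(0) = mu. This carries divergence of the
    weighted energy over to the unweighted one. *)
Lemma profile_weighted_le (p : R) (f : R -> R) (lambda mu : R) (u : R -> R) (x : R) :
  1 <= p -> radial_profile p f lambda mu u -> 0 <= x < 1 ->
  RInt (fun r => lambda * powr (u r) (p - 1) * f (u r) * r) 0 x
  <= Rpower mu (p - 1) * RInt (fun r => lambda * f (u r) * r) 0 x.
Proof.
intros Hp H Hx.
assert (HI := profile_flux _ _ _ _ _ H 0 x ltac:(lra) ltac:(lra)).
assert (HI' : ex_RInt (fun r => lambda * f (u r) * r) 0 x) by (eexists; apply HI).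
rewrite <- (RInt_scal _ _ _ (Rpower mu (p - 1)) HI' : _ = Rpower mu (p - 1) * _).
apply RInt_le; [lra|apply (profile_weighted _ _ _ _ _ H); lra|apply (@ex_RInt_scal R_NormedModule), HI'|].
intros r Hr; unfold scal; simpl; unfold mult; simpl.
assert (Hu := profile_pos _ _ _ _ _ H r ltac:(lra)).
assert (Hd := profile_decr _ _ _ _ _ H 0 r ltac:(lra) ltac:(lra)).
rewrite (profile_0 _ _ _ _ _ H) in Hd.
assert (H0 := profile_source_ge _ _ _ _ _ H r ltac:(lra)).
rewrite powr_pos_eq by lra.
replace (lambda * Rpower (u r) (p - 1) * f (u r) * r)
  with (Rpower (u r) (p - 1) * (lambda * f (u r) * r)) by ring.
apply Rmult_le_compat_r; [exact H0|apply Rpower_base_le; lra].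
Qed.

(** * Limits of the rescaled bubble coordinates *)

Section Asymptotics.
Variables (p : R) (h : R -> R) (t0 : R) (a delta lambda mu : nat -> R)
  (u : nat -> R -> R) (rc : nat -> nat -> R).
Hypotheses (hp : 2 < p) (ht0 : 0 < t0)
  (h_pos : forall t, t0 <= t -> 0 < h t)
  (h_growth : is_lim (fun t => ln (h t) / Rpower t p) p_infty 0)
  (hpar : bubble_parameters p a delta)
  (lambda_pos : forall n, 0 < lambda n)
  (mu_pos : forall n, 0 < mu n)
  (hprof : forall n, radial_profile p (nonlinearity p h) (lambda n) (mu n) (u n))
  (hmu : is_lim_seq mu p_infty)
  (hrc : bubble_centers p h a delta lambda mu u rc).

(** Heights are scaled by mu_n and logarithmic radii by mu_n^p, so slopes, that is fluxes, are
    scaled by mu_n^(1-p); concavity survives the rescaling. *)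
Let v k n := u n (rc k n) / mu n.
Let s k n := - ln (rc k n) / Rpower (mu n) p.
Let X n := ln (lambda n) / Rpower (mu n) p.

Lemma rc_bounds k n : 0 < rc k n < 1.
Proof. apply hrc. Qed.

Lemma v_lim k : is_lim_seq (v k) (delta k).
Proof. apply hrc. Qed.

Lemma v_pos k n : 0 < v k n.
Proof.
apply Rdiv_lt_0_compat; [|apply mu_pos].
apply (profile_pos _ _ _ _ _ (hprof n)); assert (H := rc_bounds k n); lra.
Qed.

Lemma s_pos k n : 0 < s k n.
Proof.
apply Rdiv_lt_0_compat; [|apply Rpower_pos].
assert (H := rc_bounds k n).
assert (ln (rc k n) < ln 1) by (apply ln_increasing; lra).
rewrite ln_1 in H0; lra.
Qed.

Lemma ln_rc k n : - ln (rc k n) = s k n * Rpower (mu n) p.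
Proof. unfold s; field; assert (H := Rpower_pos (mu n) p); lra. Qed.

Lemma u_rc k n : u n (rc k n) = v k n * mu n.
Proof. unfold v; field; assert (H := mu_pos n); lra. Qed.

Lemma delta_Rpower_le (q : R) k : 1 <= q -> Rpower (delta k) q <= delta k.
Proof.
intros Hq; assert (H := delta_pos p a delta hpar k); assert (H1 := delta_le_1 p a delta hpar k).
rewrite (Rpower_minus_1 _ q) by exact H.
assert (Rpower (delta k) (q - 1) <= Rpower 1 (q - 1)) by (apply Rpower_base_le; lra).
rewrite Rpower_1_l in H0.
rewrite <- (Rmult_1_r (delta k)) at 3; apply Rmult_le_compat_l; lra.
Qed.

Lemma mu_Rpower_lim : is_lim_seq (fun n => Rpower (mu n) p) p_infty.
Proof.
apply (is_lim_seq_le_p_loc mu); [|exact hmu].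
apply is_lim_seq_spec in hmu; generalize (hmu 1); apply filter_imp; intros n Hn.
rewrite <- (Rpower_1 (mu n)) at 1 by lra; apply Rle_Rpower; lra.
Qed.

Lemma bounded_div_mu_lim (x : nat -> R) (l : R) :
  is_lim_seq x l -> is_lim_seq (fun n => x n / Rpower (mu n) p) 0.
Proof.
intros Hx; apply (is_lim_seq_div x _ l p_infty); [exact Hx|apply mu_Rpower_lim|discriminate|].
unfold is_Rbar_div, is_Rbar_mult; simpl; f_equal; f_equal; ring.
Qed.

(** The solution decreases in r, so the center with the larger limiting height lies closer to the
    origin; the midpoint of the two limits separates the heights. *)
Lemma rc_order j k : delta j < delta k -> eventually (fun n => rc k n < rc j n).
Proof.
intros Hjk.
generalize (eventually_and _ _
  (is_lim_seq_eventually_lt _ _ ((delta j + delta k) / 2) (v_lim j) ltac:(lra))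
  (is_lim_seq_eventually_gt _ _ ((delta j + delta k) / 2) (v_lim k) ltac:(lra))).
apply filter_imp; intros n [H1 H2].
apply Rnot_le_lt; intros Hle.
assert (Hj := rc_bounds j n); assert (Hk := rc_bounds k n).
assert (Hd := profile_decr _ _ _ _ _ (hprof n) (rc j n) (rc k n) ltac:(lra) ltac:(lra)).
rewrite !u_rc in Hd; apply Rmult_le_reg_r in Hd; [lra|apply mu_pos].
Qed.

(** In the logarithm of the center relation, divided by mu_n^p, only ln lambda_n, 2 ln r_{k,n} and
    u_n(r_{k,n})^p survive; the last one tends to delta_k^p. *)
Lemma balance k :
  is_lim_seq (fun n => X n - 2 * s k n) (- Rpower (delta k) p).
Proof.
assert (Hdk := delta_pos p a delta hpar k).
set (V := fun n => u n (rc k n)).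
assert (HV : is_lim_seq V p_infty).
{ apply (is_lim_seq_ext (fun n => v k n * mu n)); [intros; symmetry; apply u_rc|].
  apply (is_lim_seq_mult _ _ (delta k) p_infty); [apply v_lim|exact hmu|].
  apply is_Rbar_mult_sym, is_Rbar_mult_p_infty_pos; simpl; exact Hdk. }
assert (HVpos : forall n, 0 < V n).
{ intros n; unfold V; rewrite u_rc; apply Rmult_lt_0_compat; [apply v_pos|apply mu_pos]. }
assert (HVp : forall n, Rpower (V n) p = Rpower (v k n) p * Rpower (mu n) p).
{ intros n; unfold V; rewrite u_rc, Rpower_mult_distr; auto; apply v_pos. }
assert (Hvp : is_lim_seq (fun n => Rpower (v k n) p) (Rpower (delta k) p))
  by (apply is_lim_seq_Rpower; [exact Hdk|apply v_lim]).
(* Whatever is o(t^p) is negligible against mu_n^p along V, since V^p / mu_n^p converges. It is used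
   for ln t and for ln h(t). *)
assert (Hsmall : forall g : R -> R, is_lim (fun t => g t / Rpower t p) p_infty 0 ->
  is_lim_seq (fun n => g (V n) / Rpower (mu n) p) 0).
{ intros g Hg.
  apply (is_lim_seq_ext (fun n => g (V n) / Rpower (V n) p * Rpower (v k n) p)).
  { intros n; rewrite HVp; field.
    split; apply Rgt_not_eq, Rpower_pos. }
  replace 0 with (0 * Rpower (delta k) p) by ring.
  apply is_lim_seq_mult'; [|exact Hvp].
  apply (is_lim_comp_seq (fun t => g t / Rpower t p) V p_infty 0 Hg); [|exact HV].
  exists 0%nat; intros; discriminate. }
set (T := fun n => p * lambda n * (rc k n) ^ 2 * powr (V n) (p - 1) * nonlinearity p h (V n)).
assert (HT : is_lim_seq (fun n => ln (T n)) (ln ((a k) ^ 2 / 2))).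
{ apply (is_lim_seq_continuous ln); [|apply hrc].
  eapply derive_continuity_pt, is_derive_Reals, derivable_pt_lim_ln.
  assert (H := a_bounds p a delta hpar k).
  assert (0 < (a k) ^ 2) by (apply pow_lt; lra); lra. }
apply (is_lim_seq_ext_loc (fun n => ln (T n) / Rpower (mu n) p
   - ln p / Rpower (mu n) p - (p - 1) * (ln (V n) / Rpower (mu n) p)
   - ln (h (V n)) / Rpower (mu n) p - Rpower (v k n) p)).
{ apply is_lim_seq_spec in HV; generalize (HV t0); apply filter_imp; intros n Hn.
  assert (HM := Rpower_pos (mu n) p); assert (Hr := rc_bounds k n).
  assert (Hh := h_pos (V n) ltac:(lra)); assert (Hl := lambda_pos n).
  assert (E : ln (T n) = ln p + ln (lambda n) + 2 * ln (rc k n) + (p - 1) * ln (V n)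
    + ln (h (V n)) + Rpower (v k n) p * Rpower (mu n) p).
  { unfold T, nonlinearity; rewrite !powr_pos_eq by apply HVpos.
    assert (0 < (rc k n) ^ 2) by (apply pow_lt; lra).
    assert (HQ := Rpower_pos (V n) (p - 1)); assert (HE := exp_pos (Rpower (V n) p)).
    assert (Hpl : 0 < p * lambda n) by (apply Rmult_lt_0_compat; lra).
    assert (Hplr : 0 < p * lambda n * rc k n ^ 2) by (apply Rmult_lt_0_compat; lra).
    rewrite ln_mult; [|apply Rmult_lt_0_compat; lra|apply Rmult_lt_0_compat; lra].
    rewrite !ln_mult by lra.
    rewrite ln_pow, ln_exp, <- HVp by lra.
    unfold Rpower at 1; rewrite ln_exp; simpl INR; ring. }
  rewrite E; unfold X, s; field; lra. }
replace (- Rpower (delta k) p)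
  with (0 - 0 - (p - 1) * 0 - 0 - Rpower (delta k) p) by ring.
apply is_lim_seq_minus'; [|exact Hvp].
apply is_lim_seq_minus'; [|apply (Hsmall (fun t => ln (h t)) h_growth)].
apply is_lim_seq_minus'; [|apply (is_lim_seq_scal_l _ (p - 1) 0), (Hsmall ln), is_lim_ln_div_Rpower; lra].
apply is_lim_seq_minus'; [apply (bounded_div_mu_lim _ _ HT)|].
apply (bounded_div_mu_lim _ (ln p)), is_lim_seq_const.
Qed.

(** Subtracting two instances of [balance] cancels X, so the differences of the s_k are known before
    X is. *)
Lemma s_diff_lim j k :
  is_lim_seq (fun n => s j n - s k n) ((Rpower (delta j) p - Rpower (delta k) p) / 2).
Proof.
apply (is_lim_seq_ext (fun n => / 2 * ((X n - 2 * s k n) - (X n - 2 * s j n)))).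
{ intros n; field. }
replace ((Rpower (delta j) p - Rpower (delta k) p) / 2)
  with (/ 2 * (- Rpower (delta k) p - - Rpower (delta j) p)) by field.
apply (is_lim_seq_scal_l _ (/ 2) (- Rpower (delta k) p - - Rpower (delta j) p)).
apply is_lim_seq_minus'; apply balance.
Qed.

Lemma ln_lambda_lim : is_lim_seq X 0.
Proof.
apply is_lim_seq_spec; intros eps; simpl.
assert (Heps := cond_pos eps).
(* The bound 1/2 keeps v_0 - v_k eventually above 1/4, so the chord inequality yields s_k < 4
   delta_k; then X < 2 s_k < 8 delta_k < eps. The lower bound for X comes from [balance] and s_k >
   0. *)
destruct (delta_small p a delta hp hpar (Rmin (1 / 2) (eps / 8))) as [k Hk].
{ apply Rmin_pos; lra. }
assert (Hk1 := Rmin_l (1 / 2) (eps / 8)); assert (Hk2 := Rmin_r (1 / 2) (eps / 8)).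
assert (Hdk := delta_pos p a delta hpar k).
assert (HP := Rpower_pos (delta k) p).
assert (HPd := delta_Rpower_le p k ltac:(lra)).
assert (Hd0 : delta 0%nat = 1) by apply hpar.
assert (L1 : is_lim_seq (fun n => v 0%nat n - v k n) (1 - delta k)).
{ rewrite <- Hd0; apply is_lim_seq_minus'; apply v_lim. }
assert (L2 : is_lim_seq (fun n => v k n * (s 0%nat n - s k n))
   (delta k * ((1 - Rpower (delta k) p) / 2))).
{ apply is_lim_seq_mult'; [apply v_lim|].
  rewrite <- (Rpower_1_l p), <- Hd0 at 1; apply s_diff_lim. }
assert (L3 : delta k * ((1 - Rpower (delta k) p) / 2) < delta k).
{ rewrite <- (Rmult_1_r (delta k)) at 3; apply Rmult_lt_compat_l; lra. }
generalize (eventually_and _ _ (is_lim_seq_eventually_gt _ _ (1 / 4) L1 ltac:(lra))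
 (eventually_and _ _ (is_lim_seq_eventually_lt _ _ _ L2 L3)
 (eventually_and _ _ (is_lim_seq_eventually_lt _ _ 0 (balance k) ltac:(lra))
 (eventually_and _ _ (is_lim_seq_eventually_gt _ _ (- eps) (balance k) ltac:(lra))
   (rc_order k 0%nat ltac:(lra)))))).
apply filter_imp; intros n [A1 [A2 [A3 [A4 A5]]]].
assert (Hr0 := rc_bounds 0 n); assert (Hrk := rc_bounds k n).
assert (Hs := s_pos k n).
assert (C := profile_chord _ _ _ _ _ _ _ (hprof n) (conj (proj1 Hr0) (Rlt_le _ _ A5)) ltac:(lra)).
replace (ln (rc k n) - ln (rc 0%nat n)) with (- ln (rc 0%nat n) - - ln (rc k n)) in C by ring.
rewrite !ln_rc, !u_rc in C.
assert (Hm := Rmult_lt_0_compat _ _ (mu_pos n) (Rpower_pos (mu n) p)).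
assert (C' : (v 0%nat n - v k n) * s k n <= v k n * (s 0%nat n - s k n)).
{ apply Rmult_le_reg_r with (mu n * Rpower (mu n) p); [exact Hm|]. lra. }
assert (1 / 4 * s k n <= (v 0%nat n - v k n) * s k n) by (apply Rmult_le_compat_r; lra).
apply Rabs_def1; lra.
Qed.

Lemma s_lim k : is_lim_seq (s k) (Rpower (delta k) p / 2).
Proof.
apply (is_lim_seq_ext (fun n => / 2 * (X n - (X n - 2 * s k n)))).
{ intros n; field. }
replace (Rpower (delta k) p / 2) with (/ 2 * (0 - - Rpower (delta k) p)) by field.
apply (is_lim_seq_scal_l _ (/ 2) (0 - - Rpower (delta k) p)).
apply is_lim_seq_minus'; [apply ln_lambda_lim|apply balance].
Qed.

Lemma mu_split n : Rpower (mu n) p = mu n * Rpower (mu n) (p - 1).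
Proof. apply Rpower_minus_1, mu_pos. Qed.

(** The chord from r_{k,n} through r to 1 gives u_n(r) ln (1 / r_{k,n}) >= u_n(r_{k,n}) ln (1 / r).
    After rescaling, the lower bound has limit 2 p ln (1 / r) delta_k^(1-p), which is as large as
    desired. *)
Lemma scaled_solution_lim (r : R) : 0 < r < 1 ->
  is_lim_seq (fun n => p * Rpower (mu n) (p - 1) * u n r) p_infty.
Proof.
intros Hr; apply is_lim_seq_spec; intros M.
assert (HL : 0 < - ln r) by (assert (H := ln_increasing r 1 ltac:(lra) ltac:(lra)); rewrite ln_1 in H; lra).
set (L := - ln r) in *.
assert (HpL : 0 < p * L) by (apply Rmult_lt_0_compat; lra).
assert (HM := Rabs_pos M); assert (HM' := Rle_abs M).
(* As delta_k^p <= delta_k^2, the limit is at least 2 p L / delta_k, and this choice makes it exceed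
   |M|. *)
destruct (delta_small p a delta hp hpar (p * L / (Rabs M + 1))) as [k Hk].
{ apply Rdiv_lt_0_compat; lra. }
assert (Hdk := delta_pos p a delta hpar k).
assert (HP := Rpower_pos (delta k) p).
assert (Lim : is_lim_seq (fun n => p * L * (v k n / s k n))
  (p * L * (delta k / (Rpower (delta k) p / 2)))).
{ apply (is_lim_seq_scal_l _ (p * L) (delta k / (Rpower (delta k) p / 2))).
  apply is_lim_seq_div'; [apply v_lim|apply s_lim|lra]. }
assert (HPd : Rpower (delta k) p <= delta k * delta k).
{ rewrite Rpower_minus_1 by exact Hdk; apply Rmult_le_compat_l; [lra|].
  apply delta_Rpower_le; lra. }
assert (Hgt : M < p * L * (delta k / (Rpower (delta k) p / 2))).
{ apply Rle_lt_trans with (1 := HM').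
  replace (p * L * (delta k / (Rpower (delta k) p / 2)))
    with (2 * (p * L) * delta k / Rpower (delta k) p) by (field; lra).
  apply Rlt_div_r; [exact HP|].
  apply Rlt_div_r in Hk; [|lra].
  apply Rle_lt_trans with ((Rabs M + 1) * (delta k * delta k)).
  - apply Rmult_le_compat; lra.
  - assert (delta k * (delta k * (Rabs M + 1)) < delta k * (p * L))
      by (apply Rmult_lt_compat_l; lra).
    assert (0 < delta k * (p * L)) by (apply Rmult_lt_0_compat; lra). lra. }
assert (Lim2 : is_lim_seq (fun n => s k n * Rpower (mu n) p) p_infty).
{ apply (is_lim_seq_mult _ _ (Rpower (delta k) p / 2) p_infty); [apply s_lim|apply mu_Rpower_lim|].
  apply is_Rbar_mult_sym, is_Rbar_mult_p_infty_pos; simpl; lra. }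
apply is_lim_seq_spec in Lim2.
generalize (eventually_and _ _ (is_lim_seq_eventually_gt _ _ _ Lim Hgt) (Lim2 L)).
apply filter_imp; intros n [A B].
assert (Hrk := rc_bounds k n).
rewrite <- ln_rc in B.
assert (Hrr : rc k n < r) by (apply ln_lt_inv; unfold L in B; lra).
assert (C := profile_chord _ _ _ _ _ _ _ (hprof n) (conj (proj1 Hrk) (Rlt_le _ _ Hrr)) ltac:(lra)).
fold L in C; replace (ln r - ln (rc k n)) with (- ln (rc k n) - L) in C by (unfold L; ring).
rewrite ln_rc, u_rc, mu_split in C.
apply Rlt_le_trans with (1 := A).
assert (Hs := s_pos k n); assert (Hm := mu_pos n).
apply Rmult_le_reg_r with (s k n * mu n); [apply Rmult_lt_0_compat; lra|].
replace (p * L * (v k n / s k n) * (s k n * mu n)) with (p * (L * v k n * mu n)) by (field; lra).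
replace (p * Rpower (mu n) (p - 1) * u n r * (s k n * mu n))
  with (p * (u n r * (s k n * (mu n * Rpower (mu n) (p - 1))))) by ring.
apply Rmult_le_compat_l; lra.
Qed.

(** * Divergence of the energy *)

Let I n x := p * RInt (fun r => lambda n * powr (u n r) (p - 1)
                                * nonlinearity p h (u n r) * r) 0 x.

(** The gain is at least p u^(p-1) at r_{k',n} times the growth of the flux from r_{k,n} to
    r_{k',n}. With k' = m + 1, the flux at r_{k',n} is bounded below by the chord slope from r_{m,n}
    to r_{k',n}, and the flux at r_{k,n} above by the chord slope from there to r = 1. The two
    contributions have limits [lA] >= 2 c and [lB] < c. *)
Lemma energy_increment (k : nat) (c := Rpower (1 - 2 / p) (p - 1)) :
  exists k', eventually (fun n => I n (rc k n) + c <= I n (rc k' n)).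
Proof.
assert (Hq : 0 < 1 - 2 / p) by (assert (2 / p < 1) by (apply Rlt_div_l; lra); lra).
assert (Hc : 0 < c) by apply Rpower_pos.
assert (Hdk := delta_pos p a delta hpar k); assert (Hdk1 := delta_le_1 p a delta hpar k).
assert (HP := Rpower_pos (delta k) p).
(* This is the threshold for [lB] < c, using delta_{k'}^(p-1) <= delta_{k'}. *)
set (eta := c * Rpower (delta k) p / (2 * p)).
assert (Heta : 0 < eta)
  by (apply Rdiv_lt_0_compat; [apply Rmult_lt_0_compat; lra|lra]).
destruct (delta_small p a delta hp hpar (Rmin (delta k) eta)) as [k' Hk'].
{ apply Rmin_pos; assumption. }
assert (Hlt : delta k' < delta k) by (assert (H := Rmin_l (delta k) eta); lra).
assert (Heta' : delta k' < eta) by (assert (H := Rmin_r (delta k) eta); lra).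
clear Hk'.
(* A preceding center is needed for the lower chord; k' = 0 is excluded because delta_0 = 1 is not
   below delta_k. *)
destruct k' as [|m].
{ assert (delta 0%nat = 1) by apply hpar; lra. }
exists (S m).
assert (Hdm := delta_pos p a delta hpar m); assert (Hds := delta_pos p a delta hpar (S m)).
assert (Hx := ratio_bounds p a delta hpar m).
assert (Hxl := ratio_lower p a delta hp hpar m).
assert (Hxe := ratio_equation p a delta hpar m); cbv zeta in Hxe.
assert (Ha := a_bounds p a delta hpar m).
assert (Hds_lt : delta (S m) < delta m) by apply hpar.
set (x := delta (S m) / delta m) in *.
assert (HPx := Rpower_pos x p).
assert (HPm := Rpower_pos (delta m) p).
assert (Hx1 : 0 < 1 - Rpower x p).
{ apply Rmult_lt_reg_l with (2 + a m); [lra|].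
  rewrite <- Hxe, Rmult_0_r; apply Rmult_lt_0_compat; lra. }
assert (Ed : delta (S m) = x * delta m) by (unfold x; field; lra).
assert (EP : Rpower (delta (S m)) p = Rpower x p * Rpower (delta m) p)
  by (rewrite Ed, Rpower_mult_distr; auto; lra).
assert (HPlt : 0 < Rpower (delta m) p - Rpower (delta (S m)) p).
{ rewrite EP; assert (0 < (1 - Rpower x p) * Rpower (delta m) p)
    by (apply Rmult_lt_0_compat; lra); lra. }
set (lA := p * Rpower (delta (S m)) (p - 1) *
  ((delta m - delta (S m)) / ((Rpower (delta m) p - Rpower (delta (S m)) p) / 2))).
set (lB := p * Rpower (delta (S m)) (p - 1) * (delta k / (Rpower (delta k) p / 2))).
(* By [ratio_equation], [lA] equals (2 + a_m) x^(p-1), and x > 1 - 2/p by [ratio_lower]. *)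
assert (HA : 2 * c <= lA).
{ replace lA with ((2 + a m) * Rpower x (p - 1)).
  - assert (c <= Rpower x (p - 1)) by (apply Rpower_base_le; lra).
    apply Rmult_le_compat; lra.
  - unfold lA; rewrite EP.
    replace (2 + a m) with (2 * p * (1 - x) / (1 - Rpower x p)) by (rewrite Hxe; field; lra).
    rewrite Ed, <- Rpower_mult_distr by lra.
    rewrite (Rpower_minus_1 (delta m) p) by lra.
    assert (H := Rpower_pos (delta m) (p - 1)).
    replace (delta m * Rpower (delta m) (p - 1) - Rpower x p * (delta m * Rpower (delta m) (p - 1)))
      with ((1 - Rpower x p) * (delta m * Rpower (delta m) (p - 1))) by ring.
    field; repeat split; lra. }
assert (HB : lB < c).
{ unfold lB.
  replace (p * Rpower (delta (S m)) (p - 1) * (delta k / (Rpower (delta k) p / 2)))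
    with (Rpower (delta (S m)) (p - 1) * delta k * (2 * p) / Rpower (delta k) p) by (field; lra).
  apply Rlt_div_l; [exact HP|].
  apply Rlt_div_r in Heta'; [|lra].
  apply Rle_lt_trans with (2 := Heta').
  apply Rmult_le_compat_r; [lra|].
  rewrite <- (Rmult_1_r (delta (S m))) at 2.
  apply Rmult_le_compat; [left; apply Rpower_pos|lra|apply delta_Rpower_le; lra|lra]. }
assert (Hv' : is_lim_seq (fun n => p * Rpower (v (S m) n) (p - 1)) (p * Rpower (delta (S m)) (p - 1))).
{ apply (is_lim_seq_scal_l _ p (Rpower (delta (S m)) (p - 1))), is_lim_seq_Rpower; [lra|apply v_lim]. }
assert (Lim : is_lim_seq (fun n =>
  p * Rpower (v (S m) n) (p - 1) * ((v m n - v (S m) n) / (s m n - s (S m) n))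
  - p * Rpower (v (S m) n) (p - 1) * (v k n / s k n)) (lA - lB)).
{ apply is_lim_seq_minus'; (apply is_lim_seq_mult'; [exact Hv'|]).
  - apply is_lim_seq_div'; [apply is_lim_seq_minus'; apply v_lim|apply s_diff_lim|lra].
  - apply is_lim_seq_div'; [apply v_lim|apply s_lim|lra]. }
generalize (eventually_and _ _ (is_lim_seq_eventually_gt _ _ c Lim ltac:(lra))
 (eventually_and _ _ (rc_order _ _ Hlt) (rc_order _ _ Hds_lt))).
apply filter_imp; intros n [A1 [A2 A3]].
assert (Hrk := rc_bounds k n); assert (Hrm := rc_bounds m n); assert (Hrs := rc_bounds (S m) n).
set (w := flux (nonlinearity p h) (lambda n) (u n)).
assert (W1 := profile_slope_ge _ _ _ _ _ (hprof n) (rc k n) 1 ltac:(lra) ltac:(lra)).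
assert (W2 := profile_slope_le _ _ _ _ _ (hprof n) (rc m n) (rc (S m) n) ltac:(lra) ltac:(lra)).
assert (W3 := profile_weighted_ge p _ _ _ _ (rc k n) (rc (S m) n) ltac:(lra) (hprof n) ltac:(lra) ltac:(lra)).
fold w in W1, W2, W3.
rewrite (profile_1 _ _ _ _ _ (hprof n)), ln_1, Rminus_0_r in W1.
replace (0 - ln (rc k n)) with (- ln (rc k n)) in W1 by ring.
replace (ln (rc (S m) n) - ln (rc m n)) with (- ln (rc m n) - - ln (rc (S m) n)) in W2 by ring.
rewrite ln_rc, u_rc in W1; rewrite !ln_rc, !u_rc in W2.
rewrite u_rc, <- Rpower_mult_distr in W3 by (apply v_pos || apply mu_pos).
rewrite mu_split in W1, W2.
set (P := Rpower (mu n) (p - 1)) in *.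
assert (HPp : 0 < P) by apply Rpower_pos.
assert (Hm := mu_pos n); assert (Hsk := s_pos k n).
assert (Hsm : 0 < s m n - s (S m) n).
{ assert (ln (rc m n) < ln (rc (S m) n)) by (apply ln_increasing; lra).
  assert (0 < (s m n - s (S m) n) * Rpower (mu n) p).
  { rewrite Rmult_minus_distr_r, <- !ln_rc; lra. }
  apply Rmult_lt_reg_r with (Rpower (mu n) p); [apply Rpower_pos|lra]. }
assert (B1 : P * w (rc k n) <= v k n / s k n).
{ apply (Rle_div_r _ _ _ Hsk).
  apply Rmult_le_reg_r with (mu n); lra. }
assert (B2 : (v m n - v (S m) n) / (s m n - s (S m) n) <= P * w (rc (S m) n)).
{ apply (Rle_div_l _ _ _ Hsm).
  apply Rmult_le_reg_r with (mu n); lra. }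
set (Q := Rpower (v (S m) n) (p - 1)) in *.
assert (HQ : 0 < p * Q) by (apply Rmult_lt_0_compat; [lra|apply Rpower_pos]).
assert (D : p * Q * ((v m n - v (S m) n) / (s m n - s (S m) n) - v k n / s k n)
   <= p * Q * (P * (w (rc (S m) n) - w (rc k n)))) by (apply Rmult_le_compat_l; lra).
assert (W4 : p * (Q * P * (w (rc (S m) n) - w (rc k n)))
  <= I n (rc (S m) n) - I n (rc k n)).
{ unfold I; rewrite <- Rmult_minus_distr_l; apply Rmult_le_compat_l; [lra|exact W3]. }
lra.
Qed.

Lemma energy_mono n x y : 0 <= x <= y -> y < 1 -> I n x <= I n y.
Proof.
intros Hx Hy.
assert (H := profile_weighted_ge p _ _ _ _ x y ltac:(lra) (hprof n) Hx Hy).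
assert (Hf := profile_flux _ _ _ _ _ (hprof n) x y Hx ltac:(lra)).
assert (0 <= flux (nonlinearity p h) (lambda n) (u n) y - flux (nonlinearity p h) (lambda n) (u n) x).
{ rewrite <- (is_RInt_unique _ _ _ _ Hf).
  apply RInt_ge_0; [lra|eexists; apply Hf|].
  intros r Hr; apply (profile_source_ge _ _ _ _ _ (hprof n)); lra. }
assert (H1 := Rmult_le_pos _ _ (Rlt_le _ _ (Rpower_pos (u n y) (p - 1))) H0).
unfold I; apply Rmult_le_compat_l; lra.
Qed.

(** The increment c does not depend on k, so j applications of [energy_increment] accumulate at
    least j c. *)
Lemma energy_large (M : R) : exists k, eventually (fun n => M < I n (rc k n)).
Proof.
set (c := Rpower (1 - 2 / p) (p - 1)).
assert (Hc : 0 < c) by apply Rpower_pos.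
assert (H : forall j, exists k, eventually (fun n => INR j * c <= I n (rc k n))).
{ induction j as [|j [k Hk]].
  - exists 0%nat; exists 0%nat; intros n _; rewrite Rmult_0_l.
    assert (Hr := rc_bounds 0 n).
    assert (H := energy_mono n 0 (rc 0%nat n) ltac:(lra) ltac:(lra)).
    unfold I in H at 1; rewrite RInt_point in H; unfold zero in H; simpl in H; lra.
  - destruct (energy_increment k) as [k' Hk']; exists k'.
    generalize (eventually_and _ _ Hk Hk'); apply filter_imp; intros n [H1 H2].
    fold c in H2; rewrite S_INR; lra. }
destruct (INR_unbounded (M / c)) as [j Hj]; apply Rlt_div_l in Hj; [|exact Hc].
destruct (H j) as [k Hk]; exists k.
revert Hk; apply filter_imp; intros n Hn; lra.
Qed.

(** For fixed k the ratio u_n / mu_n tends to delta_k > 0 at r_{k,n} but to 0 at r_n, so r_n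
    eventually lies beyond r_{k,n} and its energy is at least as large. *)
Lemma energy_lim (rs : nat -> R) :
  (forall n, 0 < rs n < 1) -> is_lim_seq (fun n => u n (rs n) / mu n) 0 ->
  is_lim_seq (fun n => I n (rs n)) p_infty.
Proof.
intros Hrs Hlim; apply is_lim_seq_spec; intros M.
destruct (energy_large M) as [k Hk].
assert (Hdk := delta_pos p a delta hpar k).
generalize (eventually_and _ _ Hk (eventually_and _ _
  (is_lim_seq_eventually_lt _ _ (delta k / 2) Hlim ltac:(lra))
  (is_lim_seq_eventually_gt _ _ (delta k / 2) (v_lim k) ltac:(lra)))).
apply filter_imp; intros n [H1 [H2 H3]].
assert (Hr := rc_bounds k n); assert (Hr' := Hrs n).
assert (rc k n <= rs n).
{ apply Rnot_lt_le; intros Hl.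
  assert (Hd := profile_decr _ _ _ _ _ (hprof n) (rs n) (rc k n) ltac:(lra) ltac:(lra)).
  apply (Rmult_le_compat_r (/ mu n)) in Hd;
    [|left; apply Rinv_0_lt_compat, mu_pos].
  unfold v in H3; unfold Rdiv in *; lra. }
assert (H4 := energy_mono n (rc k n) (rs n) ltac:(lra) ltac:(lra)); lra.
Qed.

Lemma scaled_energy_lim (rs : nat -> R) :
  (forall n, 0 < rs n < 1) -> is_lim_seq (fun n => u n (rs n) / mu n) 0 ->
  is_lim_seq (fun n => p * Rpower (mu n) (p - 1)
     * RInt (fun r => lambda n * nonlinearity p h (u n r) * r) 0 (rs n)) p_infty.
Proof.
intros Hrs Hlim; apply (is_lim_seq_le_p_loc (fun n => I n (rs n)));
  [|apply energy_lim; assumption].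
exists 0%nat; intros n _; unfold I; rewrite Rmult_assoc; apply Rmult_le_compat_l; [lra|].
assert (H := Hrs n).
apply (profile_weighted_le p _ _ _ _ _ ltac:(lra) (hprof n)); lra.
Qed.

End Asymptotics.

(** * Assembly of the limits *)

Theorem theorem1p5 (p : R) (h : R -> R) (t0 : R)
  (a delta : nat -> R)
  (lambda mu : nat -> R) (u : nat -> R -> R) (rc : nat -> nat -> R)
  (hp : 2 < p)
  (h_nonneg : forall t, 0 <= t -> 0 <= h t)
  (h_C1 : C1_on half_line h)
  (ht0 : 0 < t0)
  (h_pos : forall t, t0 <= t -> 0 < h t)
  (h_lim : is_lim (fun t => Derive h t / (powr t (p - 1) * h t)) p_infty 0)
  (hpar : bubble_parameters p a delta)
  (hsol : forall n : nat, is_solution p h (lambda n) (mu n) (u n))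
  (hmu : is_lim_seq mu p_infty)
  (hrc : bubble_centers p h a delta lambda mu u rc) :
  (forall rs : nat -> R,
     (forall n : nat, 0 < rs n < 1) ->
     is_lim_seq (fun n => u n (rs n) / mu n) 0 ->
     exists phi : nat -> nat,
       strictly_increasing phi /\
       is_lim_seq
         (fun n => p * RInt (fun r => lambda (phi n)
                                      * powr (u (phi n) r) (p - 1)
                                      * nonlinearity p h (u (phi n) r) * r)
                            0 (rs (phi n)))
         p_infty /\
       is_lim_seq
         (fun n => p * powr (mu (phi n)) (p - 1)
                   * RInt (fun r => lambda (phi n)
                                    * nonlinearity p h (u (phi n) r) * r)
                          0 (rs (phi n)))
         p_infty) /\
  (exists phi : nat -> nat,
     strictly_increasing phi /\
     is_lim_seq (fun n => ln (1 / lambda (phi n)) / powr (mu (phi n)) p) 0 /\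
     (forall k : nat,
        is_lim_seq (fun n => ln (1 / rc k (phi n)) / powr (mu (phi n)) p)
                   (powr (delta k) p / 2)) /\
     (forall r : R, 0 <= r < 1 ->
        is_lim_seq (fun n => p * powr (mu (phi n)) (p - 1) * u (phi n) r)
                   p_infty)).
Proof.
assert (lambda_pos : forall n, 0 < lambda n) by (intros n; apply hsol).
assert (mu_pos : forall n, 0 < mu n) by (intros n; apply hsol).
assert (hprof := fun n => solution_profile p h _ _ _ h_nonneg (hsol n)).
assert (h_growth := ln_nonlinearity_growth p h t0 hp h_C1 ht0 h_pos h_lim).
assert (ln_inv : forall x, 0 < x -> ln (1 / x) = - ln x).
{ intros x Hx; unfold Rdiv; rewrite Rmult_1_l; apply ln_Rinv, Hx. }
split.
(* The limits hold along the given sequence, so the identity serves as the subsequence, here and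
   below. *)
- intros rs Hrs Hlim; exists (fun n => n); split; [intros i j Hij; exact Hij|split].
  + apply (energy_lim p h t0 a delta lambda mu u rc); assumption.
  + apply (is_lim_seq_ext (fun n => p * Rpower (mu n) (p - 1)
      * RInt (fun r => lambda n * nonlinearity p h (u n r) * r) 0 (rs n))).
    { intros n; rewrite powr_pos_eq by apply mu_pos; reflexivity. }
    apply (scaled_energy_lim p h t0 a delta lambda mu u rc); assumption.
- exists (fun n => n); split; [intros i j Hij; exact Hij|split; [|split]].
  + apply (is_lim_seq_ext (fun n => -1 * (ln (lambda n) / Rpower (mu n) p))).
    { intros n; rewrite powr_pos_eq, ln_inv by auto; unfold Rdiv; ring. }
    replace 0 with (-1 * 0) by ring.
    apply (is_lim_seq_scal_l _ (-1) 0); apply (ln_lambda_lim p h t0 a delta lambda mu u rc); assumption.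
  + intros k.
    apply (is_lim_seq_ext (fun n => - ln (rc k n) / Rpower (mu n) p)).
    { intros n; rewrite powr_pos_eq, ln_inv; auto; apply hrc. }
    rewrite powr_pos_eq by (eapply delta_pos; eassumption).
    apply (s_lim p h t0 a delta lambda mu u rc); assumption.
  + intros r Hr.
    (* The chord argument needs a positive radius; moving outward to r' covers r = 0 and only
       decreases u_n. *)
    set (r' := Rmax r (1 / 2)).
    assert (Hr' : r <= r' /\ 0 < r' < 1).
    { assert (H1 := Rmax_l r (1 / 2)); assert (H2 := Rmax_r r (1 / 2)).
      unfold r'; repeat split; try lra; apply Rmax_lub_lt; lra. }
    apply (is_lim_seq_le_p_loc (fun n => p * Rpower (mu n) (p - 1) * u n r')).
    * exists 0%nat; intros n _; rewrite powr_pos_eq by apply mu_pos.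
      apply Rmult_le_compat_l; [apply Rmult_le_pos; [lra|left; apply Rpower_pos]|].
      apply (profile_decr _ _ _ _ _ (hprof n)); lra.
    * apply (scaled_solution_lim p h t0 a delta lambda mu u rc); auto; lra.
Qed.
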